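(* The generalized normal ruled surface $F_{(\alpha,q_n)}$ is developable if and only if $f=0$ (identically on $I$).
   Context: Let $I\subset\mathbb{R}$ be an open interval and $\alpha:I\to\mathbb{R}^3$ a smooth unit speed curve with arclength parameter $s$, positively oriented orthonormal Frenet frame $\{\vec T,\vec N,\vec B\}$, curvature $\kappa$ and torsion $\tau$: $\vec T=\vec\alpha'$, $\vec T'=\kappa\vec N$, $\vec N'=-\kappa\vec T+\tau\vec B$, $\vec B'=-\tau\vec N$ (prime is $d/ds$). Convention: either $\kappa>0$ on $I$, or $\alpha$ is a straight line, in which case $\kappa=\tau=0$ and $\vec N,\vec B$ are chosen constant. Let $a_1,a_2:I\to\mathbb{R}$ be smooth with $a_1^2+a_2^2=1$. The generalized normal ruled surface (GNR-surface) of $\alpha$ is $\vec F_{(\alpha,q_n)}(s,u)=\vec\alpha(s)+u\,\vec q_n(s)$, $(s,u)\in I\times\mathbb{R}$, with ruling $\vec q_n=a_1\vec N+a_2\vec B$. Put $f(s)=a_1'(s)a_2(s)-a_1(s)a_2'(s)-\tau(s)$. A ruled surface $\vec\alpha(s)+u\vec q(s)$ is called developable if its surface normal does not change along each ruling; equivalently, $\det(\vec\alpha',\vec q,\vec q\,')=0$ for all $s$. *)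

(* Defs.v *)
From HB Require Import structures.
From mathcomp Require Import all_boot all_order all_algebra.
From mathcomp Require Import all_classical all_reals all_analysis.
Import Order.TTheory GRing.Theory Num.Theory.
Import numFieldNormedType.Exports.

Set Implicit Arguments.
Unset Strict Implicit.
Unset Printing Implicit Defensive.

Local Open Scope classical_set_scope.
Local Open Scope ring_scope.

Definition dotv (R : realType) (u v : 'rV[R]_3) : R := \sum_(i < 3) u 0 i * v 0 i.

(* The library norm `|u| on 'rV[R]_3 is the sup norm, hence the need for the
   Euclidean one. *)
Definition normv (R : realType) (u : 'rV[R]_3) : R := Num.sqrt (dotv u u).

(* Indices are added in 'I_3, i.e. modulo 3. *)
Definition crossv (R : realType) (u v : 'rV[R]_3) : 'rV[R]_3 :=
  \row_(i < 3) (u 0 (i + 1) * v 0 (i + 2%:R) - u 0 (i + 2%:R) * v 0 (i + 1)).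

Definition det3 (R : realType) (u v w : 'rV[R]_3) : R :=
  \det (\matrix_(i < 3) [:: u; v; w]`_i).

(* Functions on an open set I are represented by total functions on R, of which
   only the values on I are ever constrained. *)
Definition smooth_on (R : realType) (V : normedModType R) (I : set R)
    (g : R -> V) : Prop :=
  forall (n : nat) (s : R), I s -> derivable (derive1n n g) s 1.

Definition unit_speed_on (R : realType) (I : set R) (alpha : R -> 'rV[R]_3) : Prop :=
  forall s, I s -> normv (derive1 alpha s) = 1.

Record positive_orthonormal (R : realType) (t n b : 'rV[R]_3) : Prop :=
  PositiveOrthonormal {
    po_tt : dotv t t = 1;
    po_nn : dotv n n = 1;
    po_bb : dotv b b = 1;
    po_tn : dotv t n = 0;
    po_tb : dotv t b = 0;
    po_nb : dotv n b = 0;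
    po_orient : 0 < det3 t n b }.

Definition straight_line_on (R : realType) (I : set R) (alpha : R -> 'rV[R]_3) : Prop :=
  exists p v : 'rV[R]_3, forall s, I s -> alpha s = p + s *: v.

Definition constant_on (R : realType) (V : Type) (I : set R) (g : R -> V) : Prop :=
  exists c : V, forall s, I s -> g s = c.

Record frenet_apparatus (R : realType) (I : set R)
    (alpha T N B : R -> 'rV[R]_3) (kappa tau : R -> R) : Prop :=
  FrenetApparatus {
    frenet_frame : forall s, I s -> positive_orthonormal (T s) (N s) (B s);
    frenet_tangent : forall s, I s -> is_derive s 1 alpha (T s);
    frenet_T : forall s, I s -> is_derive s 1 T (kappa s *: N s);
    frenet_N : forall s, I s ->
      is_derive s 1 N (- kappa s *: T s + tau s *: B s);
    frenet_B : forall s, I s -> is_derive s 1 B (- tau s *: N s);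
    frenet_convention :
      (forall s, I s -> 0 < kappa s) \/
      [/\ straight_line_on I alpha,
          forall s, I s -> kappa s = 0,
          forall s, I s -> tau s = 0,
          constant_on I N & constant_on I B] }.

Definition ruled_surface (R : realType) (alpha q : R -> 'rV[R]_3) (s u : R)
  : 'rV[R]_3 := alpha s + u *: q s.

Definition surface_normal (R : realType) (F : R -> R -> 'rV[R]_3) (s u : R)
  : 'rV[R]_3 :=
  crossv (derive1 (fun s' => F s' u) s) (derive1 (F s) u).

Definition unit_normal (R : realType) (F : R -> R -> 'rV[R]_3) (s u : R)
  : 'rV[R]_3 :=
  (normv (surface_normal F s u))^-1 *: surface_normal F s u.

Definition regular_point (R : realType) (F : R -> R -> 'rV[R]_3) (s u : R) : Prop :=
  surface_normal F s u != 0.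

(* The normal exists only at regular points, and it is the normal line that has
   to be constant along the rulings s = const: when a ruling of a developable
   surface crosses a singular point (apex of a cone, edge of regression), the
   unit vector F_s x F_u / |F_s x F_u| changes sign although the tangent plane
   does not turn. *)
Definition developable (R : realType) (I : set R) (alpha q : R -> 'rV[R]_3) : Prop :=
  let F := ruled_surface alpha q in
  forall s u v, I s -> regular_point F s u -> regular_point F s v ->
    unit_normal F s u = unit_normal F s v \/
    unit_normal F s u = - unit_normal F s v.

Definition gnr_ruling (R : realType) (N B : R -> 'rV[R]_3) (a1 a2 : R -> R) (s : R)
  : 'rV[R]_3 := a1 s *: N s + a2 s *: B s.

Definition gnr_f (R : realType) (a1 a2 tau : R -> R) (s : R) : R :=
  derive1 a1 s * a2 s - a1 s * derive1 a2 s - tau s.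

(* Main.v *)
Require Import Defs.
From mathcomp Require Import all_boot all_order all_algebra.
From mathcomp Require Import ring lra.
From mathcomp Require Import all_classical all_reals all_analysis.
Import Order.TTheory GRing.Theory Num.Theory.
Import numFieldNormedType.Exports.
Local Open Scope classical_set_scope.
Local Open Scope ring_scope.

(** Write $q = a_1 N + a_2 B$ for the ruling.  The Frenet equations turn the
normal $F_s \times F_u$ of the surface $F(s,u) = \alpha(s) + u q(s)$ into
[[
  (1 - u \kappa a_1) (T \times q)  +  u f (N \times B)
]]
([surface_normal_gnr]).  If $f$ vanishes, then along a ruling the normal is a
multiple of the fixed vector $T \times q$, so that unit normals at regular
points agree up to sign.

Conversely, suppose that $f(s) \neq 0$ and compare the points $u = 0$ and
$u = 1$ of the ruling through $\alpha(s)$ by taking scalar products with $T$.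
At $u = 0$ the normal is $T \times q$, which is orthogonal to $T$; at $u = 1$
its $T$-component is $f \det(T, N, B)$, which is nonzero because the frame is
positively oriented.  This also shows that $u = 1$ is a regular point; so is
$u = 0$, because $T \times q$ has scalar product $\det(T, N, B)$ with
$a_1 B - a_2 N$ ([dotv_crossv_gnr]).  The two unit normals are thus neither
equal nor opposite.

The value $u = 1$ is safe although the coefficient $1 - u \kappa a_1$ may
vanish there: the $N \times B$ term alone keeps the normal nonzero. *)

(** Differentiation of row vectors is coordinatewise, which reduces this
product rule to the scalar one. *)
Lemma is_derive_scale (R : realType) (n : nat) (a : R -> R) (v : R -> 'rV[R]_n)
    (s da : R) (dv : 'rV[R]_n) :
  is_derive s 1 a da -> is_derive s 1 v dv ->
  is_derive s 1 (fun t => a t *: v t) (da *: v s + a s *: dv).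
Proof.
move=> a_s v_s.
have dvE i j : is_derive s 1 (fun t => v t i j) (dv i j).
  have dvv : derivable v s 1 by [].
  apply: DeriveDef; first exact: ((derivable_mxP v s 1).1 dvv).
  by have [_ <-] := v_s; rewrite derive_mx // mxE.
have avE i j : is_derive s 1 (fun t => (a t *: v t) i j)
    (a s * dv i j + v s i j * da).
  have -> : (fun t => (a t *: v t) i j) = a * (fun t => v t i j).
    by apply/funext => t; rewrite mxE.
  exact: is_deriveM.
have av_s : derivable (fun t => a t *: v t) s 1.
  by apply/derivable_mxP => i j; have [] := avE i j.
apply: DeriveDef => //; rewrite derive_mx //; apply/matrixP => i j.
by rewrite !mxE; have [_ ->] := avE i j; ring.
Qed.

Lemma dotvE (R : realType) (u v : 'rV[R]_3) :
  dotv u v = u 0 0 * v 0 0 + u 0 1 * v 0 1 + u 0 2%:R * v 0 2%:R.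
Proof.
rewrite /dotv !big_ord_recl big_ord0 addr0 addrA.
by congr (_ * _ + _ * _ + _ * _); congr (_ 0 _); apply: val_inj.
Qed.

Lemma crossvE (R : realType) (u v : 'rV[R]_3) :
  ((crossv u v 0 0 = u 0 1 * v 0 2%:R - u 0 2%:R * v 0 1) *
   (crossv u v 0 1 = u 0 2%:R * v 0 0 - u 0 0 * v 0 2%:R) *
   (crossv u v 0 2%:R = u 0 0 * v 0 1 - u 0 1 * v 0 0))%type.
Proof.
by do 2?split; rewrite mxE; congr (_ * _ - _ * _); congr (_ 0 _);
  apply: val_inj.
Qed.

Lemma row3P (R : realType) (u v : 'rV[R]_3) :
  u 0 0 = v 0 0 -> u 0 1 = v 0 1 -> u 0 2%:R = v 0 2%:R -> u = v.
Proof.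
move=> e0 e1 e2; apply/rowP => -[[|[|[|//]]] i3].
- by have -> : Ordinal i3 = 0 by apply: val_inj.
- by have -> : Ordinal i3 = 1 by apply: val_inj.
- by have -> : Ordinal i3 = 2%:R by apply: val_inj.
Qed.

Lemma det3E (R : realType) (u v w : 'rV[R]_3) : det3 u v w = dotv u (crossv v w).
Proof.
(* Reading the entries of a vector through nat indices lets the ordinals that
   come out of the cofactor expansion be compared by computation. *)
have natE (x : 'rV[R]_3) : exists f : nat -> R, forall i, x 0 i = f i.
  by exists (fun k => x 0 (inord k)) => i; rewrite inord_val.
rewrite dotvE !crossvE.
rewrite /det3 (expand_det_row _ 0) !big_ord_recl big_ord0 /cofactor.
rewrite !(expand_det_row _ 0) !big_ord_recl !big_ord0 /cofactor !det_mx11 !mxE /=.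
have [[[f fE] [g gE]] [h hE]] := (natE u, natE v, natE w).
by rewrite !(fE, gE, hE) /= /bump /=; ring.
Qed.

Lemma dotvZr (R : realType) (c : R) (u v : 'rV[R]_3) :
  dotv u (c *: v) = c * dotv u v.
Proof. by rewrite !dotvE !mxE; ring. Qed.

Lemma dotv0r (R : realType) (u : 'rV[R]_3) : dotv u 0 = 0.
Proof. by rewrite dotvE !mxE; ring. Qed.

Lemma dotvDr (R : realType) (u v w : 'rV[R]_3) :
  dotv u (v + w) = dotv u v + dotv u w.
Proof. by rewrite !dotvE !mxE; ring. Qed.

Lemma dotv_crossv (R : realType) (u v : 'rV[R]_3) : dotv u (crossv u v) = 0.
Proof. by rewrite dotvE !crossvE; ring. Qed.

Lemma normvZ (R : realType) (c : R) (u : 'rV[R]_3) :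
  normv (c *: u) = `|c| * normv u.
Proof.
have -> : normv (c *: u) = Num.sqrt (c ^+ 2 * dotv u u).
  by congr (Num.sqrt _); rewrite !dotvE !mxE; ring.
by rewrite sqrtrM ?sqr_ge0 // sqrtr_sqr.
Qed.

Lemma normv_neq0 (R : realType) (u : 'rV[R]_3) : u != 0 -> normv u != 0.
Proof.
apply: contra; rewrite sqrtr_eq0 dotvE -!expr2 => le0.
have [s0 s1 s2] : [/\ 0 <= u 0 0 ^+ 2, 0 <= u 0 1 ^+ 2 & 0 <= u 0 2%:R ^+ 2].
  by split; exact: sqr_ge0.
have z0 : u 0 0 ^+ 2 = 0 by lra.
have z1 : u 0 1 ^+ 2 = 0 by lra.
have z2 : u 0 2%:R ^+ 2 = 0 by lra.
by apply/eqP/row3P; rewrite mxE; apply/eqP; rewrite -sqrf_eq0 ?z0 ?z1 ?z2.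
Qed.

(** Normalizing forgets the factor [c] except for its sign, so that nonzero
multiples of one vector have equal or opposite unit vectors. *)
Lemma normalize_collinear (R : realType) (c : R) (w : 'rV[R]_3) :
  c *: w != 0 ->
  (normv (c *: w))^-1 *: (c *: w) = Num.sg c *: ((normv w)^-1 *: w).
Proof.
rewrite scaler_eq0 negb_or => /andP[c0 w0].
rewrite normvZ invfM !scalerA; congr (_ *: _).
have c1 : `|c| != 0 by rewrite normr_eq0.
have w1 := normv_neq0 _ _ w0.
by rewrite [X in _ * X = _]numEsg; field; rewrite w1 c1.
Qed.

(** The left argument is $F_s$ once the Frenet equations are substituted, with
[t], [n], [b], [k] the frame and the curvature at one point, and [da1], [da2]
the derivatives of the coefficients.  The identity is bilinearity of the cross
product: the $t$-component $-k a_1 t$ of $q'$ joins $F_s$'s own $t$, and the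
rest is a multiple of $n \times b$ as $q$ is a combination of [n] and [b]. *)
Lemma crossv_gnr (R : realType) (t n b : 'rV[R]_3) (k tau a1 a2 da1 da2 u : R) :
  crossv
    (t + u *: (da1 *: n + a1 *: (- k *: t + tau *: b)
               + (da2 *: b + a2 *: (- tau *: n))))
    (a1 *: n + a2 *: b)
  = (1 - u * k * a1) *: crossv t (a1 *: n + a2 *: b)
    + (u * (da1 * a2 - a1 * da2 - tau * (a1 ^+ 2 + a2 ^+ 2))) *: crossv n b.
Proof.
by apply: row3P; rewrite [RHS]mxE [X in _ = X + _]mxE [X in _ = _ + X]mxE;
  rewrite !crossvE !mxE; ring.
Qed.

Lemma surface_normal_ruled (R : realType) (alpha q : R -> 'rV[R]_3)
    (s u : R) (dalpha dq : 'rV[R]_3) :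
  is_derive s 1 alpha dalpha -> is_derive s 1 q dq ->
  surface_normal (ruled_surface alpha q) s u = crossv (dalpha + u *: dq) (q s).
Proof.
move=> alpha_s q_s; rewrite /surface_normal !derive1E; congr crossv.
  by have [_ ->] := is_deriveD alpha_s (is_deriveZ u q_s).
have [_ ->] := is_deriveD (is_derive_cst (alpha s) u 1)
  (is_derive_scale _ _ _ _ _ _ _ (is_derive_id u 1) (is_derive_cst (q s) u 1)).
by rewrite add0r scale1r scaler0 addr0.
Qed.

(** Serves to show $t \times q \neq 0$: the test vector $a_1 b - a_2 n$ is what
$t \times q$ equals in a positive orthonormal frame. *)
Lemma dotv_crossv_gnr (R : realType) (t n b : 'rV[R]_3) (a1 a2 : R) :
  dotv (a1 *: b - a2 *: n) (crossv t (a1 *: n + a2 *: b))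
  = (a1 ^+ 2 + a2 ^+ 2) * dotv t (crossv n b).
Proof.
by rewrite !dotvE !crossvE !mxE; ring.
Qed.

(** Combines the Frenet equations with [crossv_gnr]; the normalization
$a_1^2 + a_2^2 = 1$ is what makes the coefficient of $N \times B$ equal to
$u f$. *)
Lemma surface_normal_gnr (R : realType) (I : set R)
    (alpha T N B : R -> 'rV[R]_3) (kappa tau a1 a2 : R -> R) (s u : R) :
  frenet_apparatus I alpha T N B kappa tau ->
  smooth_on I a1 -> smooth_on I a2 -> I s -> a1 s ^+ 2 + a2 s ^+ 2 = 1 ->
  surface_normal (ruled_surface alpha (gnr_ruling N B a1 a2)) s u
  = (1 - u * kappa s * a1 s) *: crossv (T s) (gnr_ruling N B a1 a2 s)
    + (u * gnr_f a1 a2 tau s) *: crossv (N s) (B s).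
Proof.
move=> [_ alpha' _ N' B' _] a1_smooth a2_smooth Is a12.
have a1' : is_derive s 1 a1 (derive1 a1 s).
  by apply: DeriveDef; [exact: (a1_smooth 0%N)|rewrite derive1E].
have a2' : is_derive s 1 a2 (derive1 a2 s).
  by apply: DeriveDef; [exact: (a2_smooth 0%N)|rewrite derive1E].
have q' := is_deriveD (is_derive_scale _ _ _ _ _ _ _ a1' (N' s Is))
                      (is_derive_scale _ _ _ _ _ _ _ a2' (B' s Is)).
rewrite (surface_normal_ruled _ _ _ _ _ _ _ (alpha' s Is) q') crossv_gnr.
by rewrite a12 mulr1.
Qed.

Theorem proposition3p6 (R : realType) (I : set R)
    (alpha T N B : R -> 'rV[R]_3) (kappa tau a1 a2 : R -> R)
    (I_open : open I) (I_interval : is_interval I)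
    (alpha_smooth : smooth_on I alpha)
    (alpha_unit_speed : unit_speed_on I alpha)
    (alpha_frenet : frenet_apparatus I alpha T N B kappa tau)
    (a1_smooth : smooth_on I a1) (a2_smooth : smooth_on I a2)
    (a12_unit : forall s, I s -> a1 s ^+ 2 + a2 s ^+ 2 = 1) :
  developable I alpha (gnr_ruling N B a1 a2) <->
  (forall s, I s -> gnr_f a1 a2 tau s = 0).
Proof.
set q := gnr_ruling N B a1 a2; set F := ruled_surface alpha q.
have normalE s u : I s -> surface_normal F s u
    = (1 - u * kappa s * a1 s) *: crossv (T s) (q s)
      + (u * gnr_f a1 a2 tau s) *: crossv (N s) (B s).
  by move=> Is; apply: surface_normal_gnr alpha_frenet _ _ Is (a12_unit s Is).
split=> [dev s Is|f0].
- apply: contrapT => /eqP f_neq0.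
  have frame_pos : 0 < dotv (T s) (crossv (N s) (B s)).
    by rewrite -det3E; case: (frenet_frame alpha_frenet Is).
  have normal0 : surface_normal F s 0 = crossv (T s) (q s).
    by rewrite normalE // !mul0r subr0 scale1r scale0r addr0.
  have T_normal1 : dotv (T s) (surface_normal F s 1) != 0.
    rewrite normalE // dotvDr !dotvZr dotv_crossv mulr0 add0r mul1r.
    by rewrite mulf_neq0 // gt_eqF.
  have regular0 : regular_point F s 0.
    rewrite /regular_point normal0; apply: contraTneq frame_pos => W0.
    have := dotv_crossv_gnr _ (T s) (N s) (B s) (a1 s) (a2 s).
    rewrite -/(q s) W0 a12_unit // mul1r => <-.
    by rewrite dotv0r ltxx.
  have regular1 : regular_point F s 1.
    by apply: contra_neq T_normal1 => ->; rewrite dotv0r.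
  have T_unit0 : dotv (T s) (unit_normal F s 0) = 0.
    by rewrite dotvZr normal0 dotv_crossv mulr0.
  have T_unit1 : dotv (T s) (unit_normal F s 1) != 0.
    by rewrite dotvZr mulf_neq0 // invr_neq0 // normv_neq0.
  move/eqP: T_unit1; apply.
  have [<- //|e] := dev s 0 1 Is regular0 regular1.
  by apply/eqP; rewrite -oppr_eq0 -mulN1r -dotvZr scaleN1r -e T_unit0.
- rewrite /developable /= -/F => s u v Is.
  have normal_f0 w : surface_normal F s w
      = (1 - w * kappa s * a1 s) *: crossv (T s) (q s).
    by rewrite normalE // f0 // mulr0 scale0r addr0.
  rewrite /regular_point /unit_normal !normal_f0 => Fu Fv.
  rewrite !normalize_collinear //.
  move: Fu Fv; rewrite !scaler_eq0 !negb_or => /andP[cu _] /andP[cv _].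
  by case: (sgrP (1 - u * kappa s * a1 s)) cu => // _ _;
    case: (sgrP (1 - v * kappa s * a1 s)) cv => // _ _;
    rewrite ?scale1r ?scaleN1r ?opprK; [left|right|right|left].
Qed.
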